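(* Let $n$ be a positive integer and let $D_n$ be the dihedral group of order $2n$. Then the following hold: (1) The maximal subgroups of $D_n$ are exactly (up to isomorphism) $D_{n/p}$, for $p\in\pi(n)$, and $C_n$. (2) $D_n$ is a PNC-group if and only if $4\nmid n$.
   Context: $D_n=\langle a,b\mid a^n=b^2=1,\ bab=a^{-1}\rangle$, $C_n$ is the cyclic group of order $n$, and $\pi(n)$ is the set of prime divisors of $n$. For a subgroup $H$ of $G$, $H^G$ denotes the normal closure of $H$ in $G$. $H$ is an NC-subgroup of $G$ if $H^GN_G(H)=G$; $G$ is a PNC-group if every subgroup of $G$ is an NC-subgroup of $G$. *)

(* Defs.v *)
From mathcomp Require Import all_boot all_fingroup zmodp all_solvable.

Set Implicit Arguments.
Unset Strict Implicit.
Unset Printing Implicit Defensive.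

Local Open Scope group_scope.

(* G is a copy of D_n, the dihedral group of order 2n. The library's type
   'D_(2n) is only meaningful for 2 <= n, whereas D_1 (which is cyclic of order
   2) is needed here, so the group is given by its presentation. *)
Definition is_dihedral (n : nat) (gT : finGroupType) (G : {group gT}) : Prop :=
  G \isog Grp (a : b : a ^+ n, b ^+ 2, b * a * b = a^-1).

(* H^G, generated by the conjugates h ^ g with h in H and g in G. *)
Definition normal_closure (gT : finGroupType) (H G : {set gT}) : {set gT} :=
  <<class_support H G>>.

Definition NC_subgroup (gT : finGroupType) (H G : {group gT}) : Prop :=
  H \subset G /\ normal_closure H G * 'N_G(H) = G.

Definition PNC_group (gT : finGroupType) (G : {group gT}) : Prop :=
  forall H : {group gT}, H \subset G -> NC_subgroup H G.

Lemma homg_dihedralE (n : nat) (gT : finGroupType) (G : {group gT}) :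
  (G \homg Grp (a : b : a ^+ n, b ^+ 2, b * a * b = a^-1))
    = (G \homg Grp (a : b : a ^+ n, b ^+ 2, a ^ b = a^-1)).
Proof.
apply/existsP/existsP => -[[a b]] /= /eqP[defG an b2 ab]; exists (a, b);
  have bV : b^-1 = b by apply/eqP; rewrite eq_invg_mul -expg2 b2.
- by rewrite /= !xpair_eqE defG an b2 conjgE bV mulgA ab !eqxx.
- by rewrite /= !xpair_eqE defG an b2 -{1}bV -mulgA -conjgE ab !eqxx.
Qed.

Lemma dihedral_exists (n : nat) :
  0 < n -> exists (gT : finGroupType) (G : {group gT}), is_dihedral n G.
Proof.
case: n => [//|[|n]] _.
  exists 'I_2, <[Zp1 : 'I_2]>%G; apply: intro_isoGrp => [|rT H].
    apply/existsP; exists (1, Zp1); rewrite /= !xpair_eqE.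
    by rewrite cycle1 joing1G !eqxx.
  case/existsP=> -[a b] /= /eqP[defH a1 b2 _].
  have {}a1 : a = 1 by rewrite -a1 expg1.
  have fP : #[b] %| #[Zp1 : 'I_2] by rewrite order_Zp1 order_dvdn b2.
  apply/homgP; exists (eltm_morphism fP).
  by rewrite morphim_cycle ?cycle_id //= eltm_id -defH a1 cycle1 joing1G.
exists (dihedral_gtype n.+2.*2), [set: gsort (dihedral_gtype n.+2.*2)]%G => rT H.
by rewrite homg_dihedralE; apply: Grp_dihedral.
Qed.

(* Main.v *)
(** If s is any element of D_n outside the rotation subgroup A = <a>, then
    s is an involution inverting A and a, s are again standard generators.
    A subgroup M not inside A contains such an s, and by the modular law
    M = (M :&: A) <s>; since A is cyclic, M lies in <a^p, s> for some prime p
    dividing n as soon as M != D_n.  For the PNC property, the normal closure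
    of <s> contains [s, a] and hence a^2, so that it is D_n unless n is even,
    when it is <a^2, s>; the normaliser of <s> contributes only the central
    rotation a^(n/2), which lies outside <a^2> exactly when 4 does not
    divide n. *)
Require Import Defs.
From mathcomp Require Import all_boot all_fingroup zmodp all_solvable.

Set Implicit Arguments.
Unset Strict Implicit.

Local Open Scope group_scope.

(** Internal form of the presentation: the exact order of [a] and [b \notin <[a]>] rule out proper
    quotients, also for [n = 1] and [n = 2]. *)
Definition dihedral_gens n (gT : finGroupType) (G : {set gT}) (a b : gT) :=
  [/\ G = <[a]> <*> <[b]>, #[a] = n, b ^+ 2 = 1, a ^ b = a^-1 & b \notin <[a]>].

Lemma cycle_norm_inv (gT : finGroupType) (a b : gT) :
  a ^ b = a^-1 -> <[b]> \subset 'N(<[a]>).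
Proof. by move=> ab; rewrite cycle_subG inE -cycleJ ab cycleV. Qed.

(** * Standard generators and the presentation *)

Section DihedralGenerators.

Variables (n : nat) (gT : finGroupType) (G : {group gT}) (a b : gT).
Hypothesis gensG : dihedral_gens n G a b.

Lemma dihedral_gens_order2 : #[b] = 2.
Proof.
case: gensG => _ _ b2 _ nab.
by apply: nt_prime_order => //; apply: contraNneq nab => ->; rewrite group1.
Qed.

Lemma dihedral_gens_mul : G = <[a]> * <[b]> :> {set gT}.
Proof. by case: gensG => -> _ _ ab _; rewrite norm_joinEr ?cycle_norm_inv. Qed.

Lemma dihedral_gens_card : #|G| = (n * 2)%N.
Proof.
rewrite dihedral_gens_mul TI_cardMg -?orderE ?dihedral_gens_order2.
  by case: gensG => _ ->.
case: gensG => _ _ _ _ nab; rewrite setIC prime_TIg ?cycle_subG //.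
by rewrite -orderE dihedral_gens_order2.
Qed.

Lemma dihedral_gens_subl : <[a]> \subset G.
Proof. by case: gensG => -> _ _ _ _; apply: joing_subl. Qed.

Lemma dihedral_gens_index : 0 < n -> #|G : <[a]>| = 2.
Proof.
move=> n_gt0; rewrite -divgS ?dihedral_gens_subl // dihedral_gens_card.
by case: gensG => _ oa _ _ _; rewrite -orderE oa mulKn.
Qed.

(** [G] satisfies the relations, so it is a quotient of a presented group [D]; the relations bound
    [#|D|] by [2n], which is [#|G|]. *)
Lemma dihedral_gens_is_dihedral : 0 < n -> is_dihedral n G.
Proof.
move=> n_gt0; have [defG oa b2 ab _] := gensG.
have homG : G \homg Grp (a : b : a ^+ n, b ^+ 2, b * a * b = a^-1).
  rewrite homg_dihedralE; apply/existsP; exists (a, b).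
  by rewrite /= !xpair_eqE -defG -oa expg_order b2 ab !eqxx.
have [dT [D dihD]] := dihedral_exists n_gt0.
suff leDG : #|D| <= #|G|.
  by apply: (isoGrp_trans _ dihD); rewrite isogEcard dihD homG leDG.
rewrite dihedral_gens_card; have := isoGrp_hom dihD.
rewrite homg_dihedralE => /existsP[[x y]] /= /eqP[<- xn y2 xy].
rewrite norm_joinEr ?cycle_norm_inv //.
apply: (@leq_trans (#[x] * #[y])); last apply: leq_mul;
  rewrite dvdn_leq ?muln_gt0 ?order_gt0 //.
- exact: dvdn_cardMg.
- by rewrite order_dvdn xn.
- by rewrite order_dvdn y2.
Qed.

(** Here [s = x * b] with [x] in [<[a]>]: [x] commutes with [a], so [s] inverts [a] as [b] does, and
    [x ^ b = x^-1] gives [s ^+ 2 = 1]. *)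
Lemma dihedral_gens_reflection s :
  s \in G -> s \notin <[a]> -> dihedral_gens n G a s.
Proof.
have [defG oa b2 ab nab] := gensG.
move=> Gs; have /mulsgP[x y Ax] : s \in <[a]> * <[b]>.
  by rewrite -dihedral_gens_mul.
rewrite (cycle2g dihedral_gens_order2) !inE => /orP[] /eqP-> defs;
  rewrite {s}defs in Gs *.
  by rewrite mulg1 Ax.
move=> nax; have [i _ defx] := cyclePmin Ax.
have xb : x ^ b = x^-1 by rewrite defx conjXg ab expgVn.
have bV : b^-1 = b by apply/eqP; rewrite eq_invg_mul -expg2 b2.
have genA z u : u \in <[a]> -> u \in <[a]> <*> <[z]>.
  by apply: subsetP; apply: joing_subl.
have gen2 z : z \in <[a]> <*> <[z]>.
  by apply: (subsetP (joing_subr _ _)); apply: cycle_id.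
split=> //.
- rewrite defG; apply/eqP; rewrite eqEsubset !join_subG !cycle_subG.
  have genb : b \in <[a]> <*> <[x * b]>.
    by rewrite -(groupMl b (genA _ _ Ax)) gen2.
  by rewrite genb !(genA _ a) ?cycle_id //= groupM ?gen2 ?(genA _ x).
- by rewrite expg2 -mulgA -{1}bV -conjgE xb mulgV.
- by rewrite conjgM (conjgE a x) defx (commuteX i (commute_refl a)) mulKg.
Qed.

End DihedralGenerators.

(** The relations give [#|G| <= #[a] * #[b] <= 2n]; a quotient of order [2n] forces equality, hence
    [#[a] = n] and [b] outside [<[a]>]. *)
Lemma is_dihedral_gens n (gT : finGroupType) (G : {group gT}) :
  0 < n -> is_dihedral n G -> exists a b, dihedral_gens n G a b.
Proof.
move=> n_gt0 dihG; have := isoGrp_hom dihG.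
rewrite homg_dihedralE => /existsP[[a b]] /= /eqP[defG an b2 ab].
have leG : n * 2 <= #|G|.
  (* The model is cyclic of order 2 with [a] sent to 1 when [n = 1], and the library's dihedral
     group otherwise. *)
  have [rT [H oH homH]] : exists (rT : finGroupType), exists2 H : {group rT},
      #|H| = (n * 2)%N & H \homg Grp (a : b : a ^+ n, b ^+ 2, b * a * b = a^-1).
    case: n n_gt0 {dihG an} => [//|[|n]] _.
      exists ('I_2 : finGroupType), <[Zp1 : 'I_2]>%G.
        by rewrite -orderE order_Zp1.
      apply/existsP; exists (1, Zp1); rewrite /= !xpair_eqE.
      by rewrite cycle1 joing1G !eqxx.
    exists (dihedral_gtype n.+2.*2), [set: gsort (dihedral_gtype n.+2.*2)]%G.
      by rewrite card_dihedral ?muln2.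
    by rewrite homg_dihedralE; apply/isoGrp_hom/Grp_dihedral.
  by rewrite -oH leq_homg ?dihG.
have leA : #[a] <= n by rewrite dvdn_leq ?order_dvdn ?an.
have leB : #[b] <= 2 by rewrite dvdn_leq ?order_dvdn ?b2.
have GM : G = <[a]> * <[b]> :> {set gT}.
  by rewrite -defG norm_joinEr ?cycle_norm_inv.
have leM : #|G| <= #[a] * #[b].
  by rewrite GM dvdn_leq ?muln_gt0 ?order_gt0 // dvdn_cardMg.
have oa : #[a] = n.
  apply/eqP; rewrite eqn_leq leA -(leq_pmul2r (ltn0Sn 1)).
  by rewrite (leq_trans leG) // (leq_trans leM) // leq_mul2l leB orbT.
exists a, b; split=> //; apply/negP => Ab.
have: #|G| <= n.
  by rewrite GM mulGSid ?cycle_subG // -orderE oa.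
by rewrite leqNgt (leq_trans _ leG) // ltn_Pmulr.
Qed.

(** * Maximal subgroups *)

Lemma dihedral_gens_sub n (gT : finGroupType) (G : {set gT}) (a b : gT) p :
  p %| n -> dihedral_gens n G a b ->
  dihedral_gens (n %/ p) (<[a ^+ p]> <*> <[b]>) (a ^+ p) b.
Proof.
move=> p_n [_ oa b2 ab nab]; split=> //.
- by rewrite orderXdiv oa.
- by rewrite conjXg ab expgVn.
- by apply: contra nab; apply/subsetP/cycleX.
Qed.

Lemma dihedral_gens_maximal_cycle n (gT : finGroupType) (G : {group gT}) a b :
  0 < n -> dihedral_gens n G a b -> maximal <[a]> G.
Proof.
move=> n_gt0 gens; apply: p_index_maximal; first exact: dihedral_gens_subl gens.
by rewrite (dihedral_gens_index gens).
Qed.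

(** This subgroup has standard generators for [n %/ p], hence order [2n/p] and prime index [p]. *)
Lemma dihedral_gens_maximal_sub n (gT : finGroupType) (G : {group gT}) a b p :
  0 < n -> p \in \pi(n) -> dihedral_gens n G a b ->
  maximal (<[a ^+ p]> <*> <[b]>) G.
Proof.
move=> n_gt0; rewrite mem_primes => /and3P[p_pr _ p_n] gens.
have sMG : <[a ^+ p]> <*> <[b]> \subset G.
  by case: gens => -> *; apply/genS/setSU/cycleX.
apply: p_index_maximal => //; rewrite -divgS //.
rewrite (dihedral_gens_card gens).
rewrite (dihedral_gens_card (dihedral_gens_sub p_n gens)).
by rewrite -{1}(divnK p_n) mulnAC mulKn // muln_gt0 divn_gt0 ?prime_gt0 //
  dvdn_leq.
Qed.

Lemma dihedral_gens_maximalP n (gT : finGroupType) (G M : {group gT}) a b :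
    0 < n -> dihedral_gens n G a b -> maximal M G ->
  M :=: <[a]> \/ exists p s,
    [/\ p \in \pi(n), dihedral_gens n G a s & M :=: <[a ^+ p]> <*> <[s]>].
Proof.
move=> n_gt0 gens maxM; have /maxgroupP[prM maxlM] := maxM.
have maxA := dihedral_gens_maximal_cycle n_gt0 gens.
have [sMA | /subsetPn[s Ms nAs]] := boolP (M \subset <[a]>).
  by left; rewrite (maxlM <[a]>%G) //; apply: maxgroupp maxA.
have Gs : s \in G := subsetP (proper_sub prM) s Ms.
have gens_s := dihedral_gens_reflection gens Gs nAs.
have oa : #[a] = n by case: gens.
right.
(* Otherwise [M] contains both [a] and [s], hence all of [G]. *)
have ltMA : #|M :&: <[a]>| < n.
  rewrite -oa orderE proper_card // properE subsetIr subsetI subxx andbT.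
  apply: contraL prM => sAM; rewrite properE negb_and negbK orbC.
  case: gens_s => -> _ _ _ _.
  by rewrite join_subG sAM cycle_subG Ms.
have dvMA : #|M :&: <[a]>| %| n by rewrite -oa orderE cardSg ?subsetIr.
(* [p] is a prime divisor of the index of [M :&: <[a]>] in [<[a]>], so that [m] divides [n %/ p],
   the order of [a ^+ p]. *)
set m := #|_| in ltMA dvMA; set p := pdiv (n %/ m).
have m_gt0 : 0 < m by rewrite cardG_gt0.
have k_gt1 : 1 < n %/ m by rewrite ltn_divRL // mul1n.
have p_pr : prime p := pdiv_prime k_gt1.
have m_dv : m * p %| n by rewrite mulnC -dvdn_divRL // pdiv_dvd.
have p_n : p %| n := dvdn_trans (dvdn_mull _ (dvdnn p)) m_dv.
have pi_p : p \in \pi(n) by rewrite mem_primes p_pr n_gt0.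
exists p, s; split=> //.
have /maxgroupp prL := dihedral_gens_maximal_sub n_gt0 pi_p gens_s.
rewrite (maxlM (<[a ^+ p]> <*> <[s]>)%G) //.
have -> : M = (M :&: <[a]>) * <[s]> :> {set gT}.
  rewrite group_modr ?cycle_subG // -(dihedral_gens_mul gens_s).
  by apply/esym/setIidPl/proper_sub.
apply: mul_subG (joing_subr _ _).
apply: (subset_trans _ (joing_subl _ _)).
(* In a cyclic group, inclusion of subgroups amounts to divisibility of their orders. *)
rewrite -(cardSg_cyclic (cycle_cyclic a)) ?subsetIr ?cycleX //.
by rewrite -orderE orderXdiv oa // dvdn_divRL.
Qed.

(** * Normal closures and the PNC property *)

Lemma normal_closure_sub (gT : finGroupType) (H G K : {group gT}) :
  H \subset K -> G \subset 'N(K) -> normal_closure H G \subset K.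
Proof. by move=> sHK nKG; rewrite gen_subG class_support_sub_norm. Qed.

Lemma dihedral_PNC n (gT : finGroupType) (G : {group gT}) a b :
  0 < n -> dihedral_gens n G a b -> ~~ (4 %| n) -> PNC_group G.
Proof.
move=> n_gt0 gens n4 H sHG; split=> //.
have sLG : normal_closure H G \subset G by apply: normal_closure_sub (normG G).
have nLG : G \subset 'N(normal_closure H G).
  by apply: norms_gen; apply: class_support_norm.
have sHL : H \subset normal_closure H G.
  by apply: sub_gen; apply: sub_class_support.
have [sHA | /subsetPn[s Hs nAs]] := boolP (H \subset <[a]>).
  (* [H] is characteristic in the cyclic normal subgroup [<[a]>], so its normaliser is already
     [G]. *)
  have nHG : G \subset 'N(H).
    apply: (@char_norm_trans _ _ <[a]>%G).
      by rewrite /= sub_cyclic_char ?cycle_cyclic.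
    apply: normal_norm; apply: index2_normal (dihedral_gens_subl gens) _.
    exact: dihedral_gens_index gens n_gt0.
  by rewrite (setIidPl nHG) mulSGid.
have gens_s := dihedral_gens_reflection gens (subsetP sHG s Hs) nAs.
have [defG oa s2 as_ _] := gens_s.
(* Take [k = n] for odd [n] and [k = n/2] for even [n], which is odd as 4 does not divide [n]. Then
   [a ^+ k] equals its inverse and is central. *)
have [k odd_k n_2k] : exists2 k, odd k & n %| k.*2.
  have [odd_n | even_n] := boolP (odd n).
    by exists n => //; rewrite -muln2 dvdn_mulr.
  exists n./2; last by rewrite even_halfK.
  apply: contraR n4 => /even_halfK even_half.
  by rewrite -(even_halfK even_n) -even_half -!muln2 -mulnA dvdn_mull.
have Ga : a \in G by rewrite -cycle_subG (dihedral_gens_subl gens).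
have [Ls La2] : s \in normal_closure H G /\ a ^+ 2 \in normal_closure H G.
  have Ls := subsetP sHL s Hs; split=> //.
  have -> : a ^+ 2 = s^-1 * s ^ a.
    have Vas : a^-1 ^ s = a by rewrite conjVg as_ invgK.
    by rewrite expg2 -{1}Vas !conjgE !mulgA.
  by rewrite groupM ?groupV // mem_gen // memJ_class_support.
have Nak : a ^+ k \in 'N_G(H).
  rewrite inE groupX // (subsetP (cent_sub H)) // (subsetP (centS sHG)) //.
  rewrite -sub_cent1 defG join_subG !cycle_subG.
  apply/andP; split; apply/cent1P.
    exact: commuteX.
  apply/commute_sym/commgP; rewrite commgEl conjXg as_ expgVn.
  rewrite -invMg -expgD addnn invg_eq1.
  by rewrite -order_dvdn oa.
apply/eqP; rewrite eqEsubset mul_subG ?subsetIl //=.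
have nLN : 'N_G(H) \subset 'N(normal_closure H G).
  exact: subset_trans (subsetIl _ _) nLG.
rewrite -(norm_joinEr nLN) {1}defG join_subG !cycle_subG.
have inL x : x \in normal_closure H G -> x \in normal_closure H G <*> 'N_G(H).
  by apply: subsetP; apply: joing_subl.
rewrite (inL s) // andbT.
(* As [k] is odd, [a] splits into a power of [a ^+ 2], in the normal closure, and [a ^+ k], in the
   normaliser. *)
have -> : a = (a ^+ 2) ^- k./2 * a ^+ k.
  by rewrite -expgM mul2n -{2}(odd_double_half k) odd_k addnC expgD mulKg.
apply: groupM; first by rewrite groupV groupX ?inL.
exact: (subsetP (joing_subr _ _)) Nak.
Qed.

(** [<[b]>] is the counterexample: its normal closure and its normaliser both lie in the proper
    subgroup generated by [a ^+ 2] and [b], normal of index 2. *)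
Lemma dihedral_not_PNC n (gT : finGroupType) (G : {group gT}) a b :
  0 < n -> dihedral_gens n G a b -> 4 %| n -> ~ PNC_group G.
Proof.
move=> n_gt0 gens n4 pnc; have [_ oa b2 ab nab] := gens.
have n2 : 2 %| n by apply: dvdn_trans n4.
have pi2 : 2 \in \pi(n) by rewrite mem_primes n_gt0.
have [prK _] := maxgroupP (dihedral_gens_maximal_sub n_gt0 pi2 gens).
have sKG := proper_sub prK.
have nKG : G \subset 'N(<[a ^+ 2]> <*> <[b]>).
  apply: normal_norm; apply: index2_normal => //.
  rewrite -divgS // (dihedral_gens_card gens).
  rewrite (dihedral_gens_card (dihedral_gens_sub n2 gens)).
  by rewrite divnK // mulKn.
have sBG : <[b]> \subset G := subset_trans (joing_subr _ _) sKG.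
have [_ defG] := pnc _ sBG.
have /negP[] := proper_subn prK.
rewrite -{1}defG mul_subG ?normal_closure_sub ?joing_subr //.
apply/subsetP=> x /setIP[].
rewrite {1}(dihedral_gens_mul gens) => /mulsgP[y z Ay Bz ->{x}].
rewrite groupMr ?(subsetP (normG _) z Bz) // => Ny.
rewrite groupM ?(subsetP (joing_subr _ _) z Bz) //.
apply: (subsetP (joing_subl _ _)).
(* [b] is the only nontrivial element of [<[b]>], so normalising [<[b]>] means commuting with
   [b]. *)
have b_y : b ^ y = b.
  have : b ^ y \in <[b]> by rewrite memJ_norm ?cycle_id.
  rewrite (cycle2g (dihedral_gens_order2 gens)) !inE => /orP[] /eqP// /eqP.
  by rewrite conjg_eq1 => /eqP b1; rewrite b1 group1 in nab.
have yb : y ^ b = y.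
  by apply/conjg_fixP/commgP/commute_sym/commgP/conjg_fixP.
have /cycleP[i defy] := Ay.
move: yb; rewrite defy conjXg ab expgVn => /eqP.
rewrite eq_invg_mul -expgD addnn -order_dvdn oa => ni.
(* From [4 %| n] and [n %| i.*2], cancelling a factor 2 makes [i] even. *)
have /dvdnP[j ->] : 2 %| i.
  by move: (dvdn_trans n4 ni); rewrite -muln2 -[4]/(2 * 2)%N dvdn_pmul2r.
by rewrite mulnC expgM mem_cycle.
Qed.

(** * Isomorphism types of maximal subgroups, and the PNC criterion *)

Theorem proposition4p1 (n : nat) (n_gt0 : (0 < n)%N) (gT : finGroupType)
    (G : {group gT}) (dihG : is_dihedral n G) :
  (forall (hT : finGroupType) (H : {group hT}),
     (exists M : {group gT}, maximal M G /\ M \isog H) <->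
     (exists2 p, p \in \pi(n) & is_dihedral (n %/ p) H) \/
     (cyclic H /\ #|H| = n)) /\
  (PNC_group G <-> ~~ (4 %| n)).
Proof.
have [a [b gens]] := is_dihedral_gens n_gt0 dihG.
have oa : #[a] = n by case: gens.
have np_gt0 p : p \in \pi(n) -> (0 < n %/ p)%N.
  rewrite mem_primes => /and3P[p_pr _ p_n].
  by rewrite divn_gt0 ?prime_gt0 // dvdn_leq.
have p_dvd p : p \in \pi(n) -> p %| n by rewrite mem_primes => /and3P[].
have dih_sub s p : dihedral_gens n G a s -> p \in \pi(n) ->
    is_dihedral (n %/ p) (<[a ^+ p]> <*> <[s]>)%G.
  move=> gens_s pi_p.
  apply: dihedral_gens_is_dihedral (np_gt0 p pi_p).
  exact: dihedral_gens_sub (p_dvd p pi_p) gens_s.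
split; last first.
  split; last exact: dihedral_PNC gens.
  by move=> pnc; apply/negP=> n4; apply: (dihedral_not_PNC n_gt0 gens n4 pnc).
move=> hT H; split.
- case=> M [/(dihedral_gens_maximalP n_gt0 gens) maxM isoMH].
  case: maxM => [defM | [p [s [pi_p gens_s defM]]]].
    right; rewrite -(isog_cyclic isoMH) -(card_isog isoMH) defM cycle_cyclic.
    by split.
  left; exists p => //; apply: (isoGrp_trans _ (dih_sub s p gens_s pi_p)).
  by rewrite isog_sym /= -defM.
- case=> [[p pi_p dihH] | [cycH oH]].
    exists (<[a ^+ p]> <*> <[b]>)%G; split.
      exact: dihedral_gens_maximal_sub gens.
    (* Since [H] is given by the presentation, a group satisfying the relations with the same order
       as [H] is isomorphic to it. *)
    apply/(isoGrpP _ dihH).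
    have [c [d gensH]] := is_dihedral_gens (np_gt0 p pi_p) dihH.
    rewrite (dihedral_gens_card gensH).
    rewrite (dihedral_gens_card (dihedral_gens_sub (p_dvd p pi_p) gens)).
    by split=> //; apply: isoGrp_hom (dih_sub b p gens pi_p).
  exists <[a]>%G; split; first exact: dihedral_gens_maximal_cycle gens.
  by rewrite isog_cyclic_card ?cycle_cyclic // cycH oH -orderE oa eqxx.
Qed.
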